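(* Let $\Phi$ be an axiom environment, $A$ an atomic formula and $e$ an evidence term. Then $\Phi \vdash A \Downarrow e$ if and only if $\Phi \vdash A \to^* e$.
   Context: Terms are first-order applicative terms $t ::= x \mid K \mid t\,t'$ ($x$ a variable, $K$ a constant symbol). Atomic formulas are $A ::= P\,t_1 \cdots t_n$ for predicate symbols $P$. A Horn formula is $B_1,\dots,B_n \Rightarrow A$ with $B_i, A$ atomic, all variables implicitly universally quantified, and $\bigcup_i \mathrm{FV}(B_i) \subseteq \mathrm{FV}(A)$ (no existential variables); $n=0$ is allowed. Evidence terms are $e ::= \kappa \mid e\,e'$ where $\kappa$ ranges over evidence constants. An axiom environment $\Phi$ is a finite set of Horn formulas labelled with pairwise distinct evidence constants, written $(\kappa : H)$. A substitution $\sigma$ maps variables to terms. Resolution judgement $\Phi \vdash A \Downarrow e$ is defined inductively by the single rule: if $(\kappa : B_1,\dots,B_n \Rightarrow A) \in \Phi$, $\sigma$ is a substitution, and $\Phi \vdash \sigma B_i \Downarrow e_i$ for all $i=1,\dots,n$, then $\Phi \vdash \sigma A \Downarrow \kappa\, e_1 \cdots e_n$. Mixed terms are $q ::= A \mid \kappa \mid q\,q'$ ($A$ atomic formula); mixed term contexts are $\mathcal{C} ::= \bullet \mid \mathcal{C}\,q \mid q\,\mathcal{C}$, and $\mathcal{C}[q]$ denotes replacing the hole $\bullet$ by $q$. Small-step resolution: if $(\kappa : B_1,\dots,B_n \Rightarrow A) \in \Phi$ and $\sigma$ is a substitution, then $\Phi \vdash \mathcal{C}[\sigma A] \to \mathcal{C}[\kappa\,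 \sigma B_1 \cdots \sigma B_n]$ for any context $\mathcal{C}$. $\Phi \vdash q \to^* q'$ denotes the reflexive–transitive closure of $\to$. *)

(* Defs.v *)
From Stdlib Require Import List Relations.

Set Implicit Arguments.

(* The symbol classes are arbitrary and pairwise disjoint; nothing is assumed
   about their cardinality or about decidability of equality. *)
Record signature : Type := Signature {
  variable : Type;
  constant : Type;
  predicate : Type;
  evidence_constant : Type
}.

Inductive term (S : signature) : Type :=
| Var (x : variable S)
| Const (K : constant S)
| TApp (t t' : term S).

Arguments Var {S} x.
Arguments Const {S} K.

(* Predicate symbols carry no fixed arity. *)
Inductive atom (S : signature) : Type :=
| Atom (P : predicate S) (ts : list (term S)).

Fixpoint term_fv (S : signature) (t : term S) : list (variable S) :=
  match t with
  | Var x => x :: nil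
  | Const _ => nil
  | TApp t1 t2 => term_fv t1 ++ term_fv t2
  end.

Definition atom_fv (S : signature) (A : atom S) : list (variable S) :=
  match A with Atom _ ts => flat_map (@term_fv S) ts end.

Definition substitution (S : signature) : Type := variable S -> term S.

Fixpoint subst_term (S : signature) (sigma : substitution S) (t : term S)
    : term S :=
  match t with
  | Var x => sigma x
  | Const K => Const K
  | TApp t1 t2 => TApp (subst_term sigma t1) (subst_term sigma t2)
  end.

Definition subst_atom (S : signature) (sigma : substitution S) (A : atom S)
    : atom S :=
  match A with Atom P ts => Atom P (map (subst_term sigma) ts) end.

Record horn (S : signature) : Type := Horn {
  body : list (atom S);
  head : atom S;
  no_existential_variables : incl (flat_map (@atom_fv S) body) (atom_fv head)
}.

(* A finite set of labelled formulas, presented as a list; distinctness of the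
   labels rules out repetitions. *)
Record axiom_env (S : signature) : Type := AxiomEnv {
  axioms : list (evidence_constant S * horn S);
  distinct_labels : NoDup (map fst axioms)
}.

Definition in_env (S : signature) (Phi : axiom_env S)
    (kappa : evidence_constant S) (H : horn S) : Prop :=
  In (kappa, H) (axioms Phi).

Inductive evidence (S : signature) : Type :=
| EConst (kappa : evidence_constant S)
| EApp (e e' : evidence S).

Arguments EConst {S} kappa.

Inductive resolves (S : signature) (Phi : axiom_env S)
    : atom S -> evidence S -> Prop :=
| Resolve (kappa : evidence_constant S) (H : horn S) (sigma : substitution S)
    (es : list (evidence S)) :
    in_env Phi kappa H ->
    Forall2 (resolves Phi) (map (subst_atom sigma) (body H)) es ->
    resolves Phi (subst_atom sigma (head H))
      (fold_left (@EApp S) es (EConst kappa)).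

Inductive mixed (S : signature) : Type :=
| MAtom (A : atom S)
| MConst (kappa : evidence_constant S)
| MApp (q q' : mixed S).

Arguments MConst {S} kappa.

Fixpoint mixed_of_evidence (S : signature) (e : evidence S) : mixed S :=
  match e with
  | EConst kappa => MConst kappa
  | EApp e1 e2 => MApp (mixed_of_evidence e1) (mixed_of_evidence e2)
  end.

Inductive mixed_context (S : signature) : Type :=
| Hole
| CAppL (C : mixed_context S) (q : mixed S)
| CAppR (q : mixed S) (C : mixed_context S).

Arguments Hole {S}.

Fixpoint fill (S : signature) (C : mixed_context S) (q : mixed S) : mixed S :=
  match C with
  | Hole => q
  | CAppL C' q' => MApp (fill C' q) q'
  | CAppR q' C' => MApp q' (fill C' q)
  end.

Inductive step (S : signature) (Phi : axiom_env S)
    : mixed S -> mixed S -> Prop :=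
| Step (kappa : evidence_constant S) (H : horn S) (sigma : substitution S)
    (C : mixed_context S) :
    in_env Phi kappa H ->
    step Phi
      (fill C (MAtom (subst_atom sigma (head H))))
      (fill C (fold_left (@MApp S)
                 (map (fun B => MAtom (subst_atom sigma B)) (body H))
                 (MConst kappa))).

Definition steps (S : signature) (Phi : axiom_env S)
    : mixed S -> mixed S -> Prop :=
  clos_refl_trans (mixed S) (step Phi).

(* Main.v *)
(** A mixed term is read as a partially built evidence term: [realizes Phi q e]
    says that [e] is obtained from [q] by replacing each atom of [q] with some
    evidence resolving it.  This relation is preserved by small steps taken
    backwards, and an evidence term realizes itself, so any reduction
    ending in [e] starts from a mixed term realized by [e].  The converse is a
    simulation of the big-step derivation. *)

From Stdlib Require Import List Relations.
Require Import Defs.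

Set Implicit Arguments.

Inductive realizes (S : signature) (Phi : axiom_env S)
    : mixed S -> evidence S -> Prop :=
| RealizesAtom (A : atom S) (e : evidence S) :
    resolves Phi A e -> realizes Phi (MAtom A) e
| RealizesConst (kappa : evidence_constant S) :
    realizes Phi (MConst kappa) (EConst kappa)
| RealizesApp (q q' : mixed S) (e e' : evidence S) :
    realizes Phi q e -> realizes Phi q' e' ->
    realizes Phi (MApp q q') (EApp e e').

Lemma realizes_mixed_of_evidence (S : signature) (Phi : axiom_env S)
    (e : evidence S) : realizes Phi (mixed_of_evidence e) e.
Proof. induction e; simpl; constructor; assumption. Qed.

(** [fold_left] absorbs the first atom into the head, so the induction needs an arbitrary [q];
    inverting the enlarged head gives that atom's evidence back. *)
Lemma realizes_fold_left_inv (S : signature) (Phi : axiom_env S)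
    (Bs : list (atom S)) (q : mixed S) (e : evidence S) :
  realizes Phi (fold_left (@MApp S) (map (@MAtom S) Bs) q) e ->
  exists e0 es, realizes Phi q e0 /\ Forall2 (resolves Phi) Bs es /\
    e = fold_left (@EApp S) es e0.
Proof.
  revert q; induction Bs as [|B Bs IH]; simpl; intros q Hq.
  - exists e, nil; auto.
  - destruct (IH _ Hq) as (e0 & es & Happ & Hes & ->).
    inversion Happ as [| |q1 q2 e1 e2 H1 H2]; subst.
    inversion H2; subst.
    exists e1, (e2 :: es); auto.
Qed.

Lemma realizes_fill (S : signature) (Phi : axiom_env S) (C : mixed_context S)
    (q q' : mixed S) :
  (forall e, realizes Phi q' e -> realizes Phi q e) ->
  forall e, realizes Phi (fill C q') e -> realizes Phi (fill C q) e.
Proof.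
  intros Hqq'; induction C as [|C IH q0|q0 C IH]; simpl; intros e He; auto;
    inversion He; subst; constructor; auto.
Qed.

(** At the hole, evidence realizing the reduct must be [kappa] applied to evidence for the
    instantiated body, which is exactly what [Resolve] consumes. *)
Lemma step_realizes (S : signature) (Phi : axiom_env S) (q q' : mixed S)
    (e : evidence S) :
  step Phi q q' -> realizes Phi q' e -> realizes Phi q e.
Proof.
  intros [kappa H sigma C Hin]; revert e; apply realizes_fill; intros e He.
  rewrite <- (map_map (subst_atom sigma) (@MAtom S)) in He.
  destruct (realizes_fold_left_inv _ _ He) as (e0 & es & He0 & Hes & ->).
  inversion He0; subst.
  constructor; constructor; assumption.
Qed.

Lemma steps_realizes (S : signature) (Phi : axiom_env S) (q q' : mixed S) :
  steps Phi q q' -> forall e, realizes Phi q' e -> realizes Phi q e.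
Proof.
  induction 1; eauto using step_realizes.
Qed.

(** A step below [D], placed inside [C], is again a single step, below the composite context. *)
Fixpoint context_comp (S : signature) (C D : mixed_context S)
    : mixed_context S :=
  match C with
  | Hole => D
  | CAppL C' q => CAppL (context_comp C' D) q
  | CAppR q C' => CAppR q (context_comp C' D)
  end.

Lemma fill_context_comp (S : signature) (C D : mixed_context S) (q : mixed S) :
  fill (context_comp C D) q = fill C (fill D q).
Proof. induction C; simpl; congruence. Qed.

Lemma steps_fill (S : signature) (Phi : axiom_env S) (C : mixed_context S)
    (q q' : mixed S) :
  steps Phi q q' -> steps Phi (fill C q) (fill C q').
Proof.
  induction 1 as [q q' [kappa H sigma D Hin]|q|q1 q2 q3 _ IH12 _ IH23].
  - apply rt_step; rewrite <- !fill_context_comp; constructor; assumption.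
  - apply rt_refl.
  - exact (rt_trans _ _ _ _ _ IH12 IH23).
Qed.

Lemma steps_app (S : signature) (Phi : axiom_env S) (q1 q1' q2 q2' : mixed S) :
  steps Phi q1 q1' -> steps Phi q2 q2' ->
  steps Phi (MApp q1 q2) (MApp q1' q2').
Proof.
  intros H1 H2; apply rt_trans with (MApp q1' q2).
  - exact (steps_fill (CAppL Hole q2) H1).
  - exact (steps_fill (CAppR q1' Hole) H2).
Qed.

Lemma steps_fold_left (S : signature) (Phi : axiom_env S) (Bs : list (atom S))
    (es : list (evidence S)) :
  Forall2 (fun B e => steps Phi (MAtom B) (mixed_of_evidence e)) Bs es ->
  forall (q : mixed S) (e : evidence S),
  steps Phi q (mixed_of_evidence e) ->
  steps Phi (fold_left (@MApp S) (map (@MAtom S) Bs) q)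
    (mixed_of_evidence (fold_left (@EApp S) es e)).
Proof.
  induction 1; simpl; intros q e Hq; auto.
  apply IHForall2; simpl; apply steps_app; assumption.
Qed.

(* The premises of [Resolve] sit inside [Forall2], so the generated induction
   principle gives no hypothesis for them; hence the explicit [fix]. *)
Lemma resolves_steps (S : signature) (Phi : axiom_env S) :
  forall (A : atom S) (e : evidence S),
  resolves Phi A e -> steps Phi (MAtom A) (mixed_of_evidence e).
Proof.
  fix IH 3; intros A e [kappa H sigma es Hin Hes].
  eapply rt_trans; [exact (rt_step _ _ _ _ (Step Phi _ H sigma Hole Hin))|].
  simpl; rewrite <- (map_map (subst_atom sigma) (@MAtom S)).
  apply steps_fold_left; [|apply rt_refl].
  (* Induction on [Hes] itself keeps each use of [IH] on a subderivation, as the guard condition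
     demands. *)
  induction Hes; constructor; auto.
Qed.

Theorem theorem1 (S : signature) (Phi : axiom_env S) (A : atom S)
    (e : evidence S) :
  resolves Phi A e <-> steps Phi (MAtom A) (mixed_of_evidence e).
Proof.
  split; [apply resolves_steps|intros Hsteps].
  assert (HA : realizes Phi (MAtom A) e)
    by exact (steps_realizes Hsteps (realizes_mixed_of_evidence Phi e)).
  inversion HA; assumption.
Qed.
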